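(* $R(B_3, B_6)\geq 17$, where $R$ denotes the two-color Ramsey number and $B_n$ denotes the book graph $K_2+\overline{K_n}$ with $n$ triangular pages.
   Context: All graphs are finite, simple and undirected. For graphs $G_1, G_2$, the two-color Ramsey number $R(G_1,G_2)$ is the least integer $n$ such that for any edge-coloring of the complete graph $K_n$ with 2 colors there exists some $i\in\{1,2\}$ such that the subgraph of $K_n$ formed by the edges of color $i$ contains a copy of $G_i$ as a (not necessarily induced) subgraph. For two graphs $G$ and $H$, the join $G+H$ is the graph obtained from the disjoint union of $G$ and $H$ by adding all the edges between a vertex of $G$ and a vertex of $H$. The book $B_n$ is the join $K_2+\overline{K_n}$, where $\overline{K_n}$ is the empty (edgeless) graph on $n$ vertices; it has $n+2$ vertices and consists of $n$ triangles sharing a common edge. *)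

(* Defs.v *)
From mathcomp Require Import all_boot.

Set Implicit Arguments.
Unset Strict Implicit.
Unset Printing Implicit Defensive.

Record sgraph := SGraph {
  vertex :> finType;
  adj : rel vertex;
  adj_sym : symmetric adj;
  adj_irrefl : irreflexive adj }.

Section Complete.
Variable n : nat.

Definition complete_adj : rel 'I_n := fun x y => x != y.

Lemma complete_adj_sym : symmetric complete_adj.
Proof. by move=> x y; rewrite /complete_adj eq_sym. Qed.

Lemma complete_adj_irrefl : irreflexive complete_adj.
Proof. by move=> x; rewrite /complete_adj eqxx. Qed.

Definition complete_graph : sgraph :=
  SGraph complete_adj_sym complete_adj_irrefl.

Definition empty_adj : rel 'I_n := fun _ _ => false.

Lemma empty_adj_sym : symmetric empty_adj.
Proof. by []. Qed.

Lemma empty_adj_irrefl : irreflexive empty_adj.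
Proof. by []. Qed.

Definition empty_graph : sgraph := SGraph empty_adj_sym empty_adj_irrefl.

End Complete.

Section Join.
Variables G H : sgraph.

Definition join_adj : rel (G + H)%type := fun u v =>
  match u, v with
  | inl x, inl y => adj x y
  | inr x, inr y => adj x y
  | _, _ => true
  end.

Lemma join_adj_sym : symmetric join_adj.
Proof. by move=> [x|x] [y|y] //=; rewrite adj_sym. Qed.

Lemma join_adj_irrefl : irreflexive join_adj.
Proof. by move=> [x|x] /=; rewrite adj_irrefl. Qed.

Definition join : sgraph := SGraph join_adj_sym join_adj_irrefl.

End Join.

Definition book (n : nat) : sgraph := join (complete_graph 2) (empty_graph n).

(* H contains a copy of G as a not necessarily induced subgraph. *)
Definition contains_copy (H G : sgraph) : bool :=
  [exists f : {ffun G -> H},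
     injectiveb f && [forall x, forall y, adj x y ==> adj (f x) (f y)]].

(* The edges of K_n are the two-element sets of vertices. *)
Definition edge (n : nat) := {e : {set 'I_n} | #|e| == 2}.

Section ColorGraph.
Variables (n : nat) (c : {ffun edge n -> bool}) (i : bool).

Definition color_adj : rel 'I_n := fun x y =>
  [exists e : edge n, (val e == [set x; y]) && (c e == i)].

Lemma color_adj_sym : symmetric color_adj.
Proof. by move=> x y; rewrite /color_adj setUC. Qed.

Lemma color_adj_irrefl : irreflexive color_adj.
Proof.
move=> x; apply/existsP => -[e /andP[/eqP ve _]].
by have := valP e; rewrite ve setUid cards1.
Qed.

Definition color_graph : sgraph := SGraph color_adj_sym color_adj_irrefl.

End ColorGraph.

(* The first colour is false, the second is true. *)
Definition arrows (G1 G2 : sgraph) (n : nat) : bool :=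
  [forall c : {ffun edge n -> bool},
     contains_copy (color_graph c false) G1
     || contains_copy (color_graph c true) G2].

Lemma ramsey_sets (T : finType) (e : rel T) (A : {set T}) (s t : nat) :
  symmetric e -> 2 ^ (s + t) <= #|A| ->
  (exists S : {set T}, [/\ S \subset A, #|S| = s &
     {in S &, forall x y, x != y -> e x y}]) \/
  (exists S : {set T}, [/\ S \subset A, #|S| = t &
     {in S &, forall x y, x != y -> ~~ e x y}]).
Proof.
move=> e_sym; move Em: (s + t) => m.
elim: m s t A Em => [|m IHm] [|s] [|t] A // Em leA;
  try by [left; exists set0; split; rewrite ?sub0set ?cards0 // => x y;
            rewrite inE
         |right; exists set0; split; rewrite ?sub0set ?cards0 // => x y;
            rewrite inE].
have /card_gt0P[x xA] : 0 < #|A| by apply: leq_trans leA; rewrite expn_gt0.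
pose N := [set y in A :\ x | e x y]; pose M := [set y in A :\ x | ~~ e x y].
have NA : N \subset A by apply/subsetP=> y; rewrite !inE => /andP[/andP[]].
have MA : M \subset A by apply/subsetP=> y; rewrite !inE => /andP[/andP[]].
have cardNM : #|A| = (#|N| + #|M|).+1.
  rewrite (cardsD1 x A) xA add1n -(cardsID [set y | e x y] (A :\ x)).
  by congr (_ + _).+1; apply: eq_card => y; rewrite !inE andbC.
have xN : x \notin N by rewrite !inE eqxx.
have xM : x \notin M by rewrite !inE eqxx.
have extend (B : {set T}) (p : rel T) (S : {set T}) (k : nat) :
    symmetric p -> B \subset A -> x \notin B -> {in B, forall y, p x y} ->
    S \subset B -> #|S| = k -> {in S &, forall y z, y != z -> p y z} ->
    [/\ x |: S \subset A, #|x |: S| = k.+1 &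
      {in x |: S &, forall y z, y != z -> p y z}].
  move=> p_sym BA xB pB SB Sk Sp; split.
  - by rewrite subUset sub1set xA (subset_trans SB).
  - by rewrite cardsU1 Sk (contra ((subsetP SB) x) xB).
  - move=> y z /setU1P[->|yS] /setU1P[->|zS] yz.
    + by rewrite eqxx in yz.
    + exact/pB/(subsetP SB).
    + by rewrite p_sym; apply/pB/(subsetP SB).
    + exact: Sp.
have eN : {in N, forall y, e x y} by move=> y; rewrite !inE => /andP[].
have eM : {in M, forall y, ~~ e x y} by move=> y; rewrite !inE => /andP[].
have ne_sym : symmetric (fun y z => ~~ e y z) by move=> y z; rewrite e_sym.
have [leN|ltN] := leqP (2 ^ m) #|N|.
  have Est : s + t.+1 = m by case: Em.
  case: (IHm _ _ N Est leN) => -[S [SN Sc Se]].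
    left; exists (x |: S).
    exact: extend e_sym NA xN eN SN Sc Se.
  by right; exists S; split=> //; apply: subset_trans NA.
have leM : 2 ^ m <= #|M|.
  rewrite leqNgt; apply/negP => ltM; move: leA.
  rewrite cardNM expnS mul2n -addnn leqNgt => /negP; apply.
  by rewrite -addnS -addSn; apply: leq_add.
have Est : s.+1 + t = m by move: Em; rewrite addnS => -[].
case: (IHm _ _ M Est leM) => -[S [SM Sc Se]].
  by left; exists S; split=> //; apply: subset_trans MA.
right; exists (x |: S).
exact: (extend M _ S t ne_sym MA xM eM SM Sc Se).
Qed.

Lemma contains_copy_clique (G H : sgraph) (S : {set H}) :
  #|S| = #|G| -> {in S &, forall x y, x != y -> adj x y} ->
  contains_copy H G.
Proof.
move=> cS Sadj.
pose f := [ffun x : G => enum_val (cast_ord (esym cS) (enum_rank x))].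
have f_inj : injective f.
  move=> x y; rewrite !ffunE => /enum_val_inj /cast_ord_inj.
  exact: enum_rank_inj.
apply/existsP; exists f; apply/andP; split; first exact/injectiveP.
apply/forallP=> x; apply/forallP=> y; apply/implyP=> xy.
have fS z : f z \in S by rewrite ffunE enum_valP.
apply: Sadj; rewrite ?fS // (inj_eq f_inj).
by apply: contraTneq xy => ->; rewrite adj_irrefl.
Qed.

Theorem ramsey_exists (G1 G2 : sgraph) : exists n, arrows G1 G2 n.
Proof.
exists (2 ^ (#|G1| + #|G2|)); apply/forallP => c.
set n := 2 ^ _ in c *.
have leT : n <= #|[set: color_graph c false]| by rewrite cardsT card_ord.
case: (ramsey_sets (adj_sym (s := color_graph c false)) leT)
  => -[S [_ cS Se]]; apply/orP; [left|right].
  exact: contains_copy_clique Se.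
apply: (@contains_copy_clique _ (color_graph c true) S cS) => x y xS yS xy.
have xy2 : #|[set x; y]| == 2 by rewrite cards2 xy.
apply/existsP; exists (Sub [set x; y] xy2); rewrite SubK eqxx /=.
have := Se x y xS yS xy; apply: contraNeq => cxy.
by apply/existsP; exists (Sub [set x; y] xy2); rewrite SubK eqxx; case: (c _) cxy.
Qed.

Definition ramsey_number (G1 G2 : sgraph) : nat :=
  ex_minn (ramsey_exists G1 G2).

(* Main.v *)
(* Colour K_16 by the 4 x 4 rook's graph: it is strongly regular with
   parameters (16,6,2,2), and its complement has parameters (16,9,4,6), so
   adjacent vertices have 2 common neighbours in the first colour and 4 in the
   second: there is no B_3 in the first colour and not even a B_5 in the
   second. *)
Require Import Defs.
From mathcomp Require Import all_boot.

(** The number [x < 16] stands for the cell in row [x %/ 4] and column [x %% 4]. Working on [nat]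
    rather than on ordinals lets [vm_compute] evaluate the neighbour counts. *)
Definition rook : rel nat := fun x y =>
  (x != y) && ((x %/ 4 == y %/ 4) || (x %% 4 == y %% 4)).

Definition corook : rel nat := fun x y => (x != y) && ~~ rook x y.

Lemma rook_sym : symmetric rook.
Proof.
by move=> x y; rewrite /rook eq_sym; congr (_ && (_ || _)); rewrite eq_sym.
Qed.

Definition common_nbrs (r : rel nat) (N u v : nat) : nat :=
  count (fun w => r u w && r v w) (iota 0 N).

(** The two spine vertices go to [u] and [v], and the pages go to [m] distinct common neighbours.
    Allowing [n <= N] makes a single count on [N] vertices serve every smaller complete graph. *)
Lemma book_common_nbrs (m n N : nat) (c : {ffun edge n -> bool}) (i : bool)
    (r : rel nat) :
  n <= N -> (forall x y : 'I_n, color_adj c i x y -> r x y) ->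
  contains_copy (color_graph c i) (book m) ->
  exists u v, [/\ u < N, v < N, r u v & m <= common_nbrs r N u v].
Proof.
move=> leN cr /existsP[f /andP[/injectiveP f_inj /forallP f_adj]].
have fr x y : adj (s := book m) x y -> r (f x : 'I_n) (f y : 'I_n).
  by move=> xy; apply: cr; move/forallP: (f_adj x) => /(_ y) /implyP; apply.
have fN x : (f x : 'I_n) < N by apply: leq_trans leN.
pose spine k : book m := inl (k : 'I_2).
exists (f (spine ord0) : 'I_n), (f (spine ord_max) : 'I_n).
split; rewrite ?fN //; first exact: fr.
pose page (j : 'I_m) : nat := (f (inr j : book m) : 'I_n).
have page_inj : injective page by move=> j k /val_inj /f_inj [].
rewrite /common_nbrs -size_filter -[leqLHS](size_enum_ord m).
rewrite -(size_map page); apply: uniq_leq_size.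
  by rewrite map_inj_uniq ?enum_uniq.
move=> _ /mapP[j _ ->]; rewrite mem_filter mem_iota /= add0n fN andbT.
by apply/andP; split; apply: fr.
Qed.

(** An edge is an unordered pair, so its endpoints are quantified over instead of being chosen. *)
Definition rook_coloring (n : nat) : {ffun edge n -> bool} :=
  [ffun e : edge n =>
     ~~ [exists x in val e, exists y in val e, rook (x : 'I_n) (y : 'I_n)]].

Lemma rook_coloring_adj (n : nat) (i : bool) (x y : 'I_n) :
  color_adj (rook_coloring n) i x y -> (if i then corook else rook) x y.
Proof.
move=> xy; have x_ne_y : x != y.
  by apply: contraTneq xy => ->; rewrite color_adj_irrefl.
case/existsP: xy => e /andP[/eqP ve /eqP <-]; rewrite ffunE ve.
have -> : [exists a in [set x; y], exists b in [set x; y],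
             rook (a : 'I_n) (b : 'I_n)] = rook x y.
  apply/idP/idP => [|xy].
    case/exists_inP=> a /set2P[]-> /exists_inP[b /set2P[]->] //.
    - by rewrite /rook eqxx.
    - by rewrite rook_sym.
    - by rewrite /rook eqxx.
  by apply/exists_inP; exists x; rewrite ?set21 //;
     apply/exists_inP; exists y; rewrite ?set22.
by case: ifP => [nr|/negbFE //]; rewrite /corook nr andbT.
Qed.

(** Reduces the bound to a closed boolean check over all pairs below [N], decidable by
    evaluation. *)
Lemma common_nbrs_bound (r : rel nat) (N k u v : nat) :
  all (fun u => all (fun v => r u v ==> (common_nbrs r N u v <= k)) (iota 0 N))
    (iota 0 N) ->
  u < N -> v < N -> r u v -> common_nbrs r N u v <= k.
Proof.
move=> /allP/(_ u) + uN; rewrite mem_iota => /(_ uN) /allP/(_ v) + vN.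
by rewrite mem_iota => /(_ vN) /implyP.
Qed.

Lemma rook_common_nbrs (u v : nat) :
  u < 16 -> v < 16 -> rook u v -> common_nbrs rook 16 u v <= 2.
Proof. by apply: common_nbrs_bound; vm_compute. Qed.

Lemma corook_common_nbrs (u v : nat) :
  u < 16 -> v < 16 -> corook u v -> common_nbrs corook 16 u v <= 4.
Proof. by apply: common_nbrs_bound; vm_compute. Qed.

Theorem theorem3p3 : 17 <= ramsey_number (book 3) (book 6).
Proof.
(* Every [n] with the arrowing property exceeds 16: otherwise the rook colouring restricted to the
   first [n] cells would contain one of the books. *)
rewrite /ramsey_number; case: ex_minnP => n /forallP/(_ (rook_coloring n)).
move=> copy _; rewrite ltnNge; apply/negP => le16.
case/orP: copy => /(book_common_nbrs _ _ _ _ _ _ le16 (@rook_coloring_adj n _)).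
  case=> u [v [u16 v16 uv]].
  by rewrite ltnNge rook_common_nbrs.
(* Six common neighbours are weakened to five, which already contradicts the bound 4. *)
case=> u [v [u16 v16 uv]] /ltnW.
by rewrite ltnNge corook_common_nbrs.
Qed.
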